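(* Let $(X,\tau)$ be a topological space and $p\in X$. Then the following properties are equivalent: (1) $\mathsf{S}_1(\Omega_p,\Omega_p)$; (2) $\mathsf{S}_k(\Omega_p,\Omega_p)$ for every $k\in\mathbb{N}$; (3) $\mathsf{S}_{\mathrm{bnd}}(\Omega_p,\Omega_p)$.
   Context: Here $\omega=\{0,1,2,\dots\}$ and $\mathbb{N}=\omega\setminus\{0\}$. For a topological space $X$ and $p\in X$, $\Omega_p=\{Y\subset X: p\in\overline{Y}\}$. Let $\mathcal{A},\mathcal{B}$ be families of sets. For $k\in\mathbb{N}$, $\mathsf{S}_k(\mathcal{A},\mathcal{B})$ holds if for every sequence $\langle A_n:n\in\omega\rangle$ of elements of $\mathcal{A}$ there is a sequence $\langle B_n:n\in\omega\rangle$ such that $B_n\subset A_n$ and $|B_n|\le k$ for every $n\in\omega$, and $\bigcup_{n\in\omega}B_n\in\mathcal{B}$. $\mathsf{S}_{\mathrm{bnd}}(\mathcal{A},\mathcal{B})$ holds if for every sequence $\langle A_n:n\in\omega\rangle$ of elements of $\mathcal{A}$ there are a sequence $\langle B_n:n\in\omega\rangle$ and a $k\in\omega$ such that $B_n\subset A_n$ is finite with $|B_n|\le k$ for every $n\in\omega$, and $\bigcup_{n\in\omega}B_n\in\mathcal{B}$. *)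

(* Defs.v *)
From mathcomp Require Import all_boot all_order.
From mathcomp Require Import boolp classical_sets functions cardinality topology.

Set Implicit Arguments.
Unset Strict Implicit.
Unset Printing Implicit Defensive.

Local Open Scope classical_set_scope.
Local Open Scope card_scope.

Definition Omega (X : topologicalType) (p : X) : set (set X) :=
  [set Y | closure Y p].

(* The cardinality bound is an inequality, so a selected set may be empty. *)
Definition S_fix (k : nat) (T : Type) (A B : set (set T)) : Prop :=
  forall An : nat -> set T, (forall n, A (An n)) ->
  exists Bn : nat -> set T,
    (forall n, Bn n `<=` An n /\ Bn n #<= `I_k) /\
    B (\bigcup_n Bn n).

Definition S_bnd (T : Type) (A B : set (set T)) : Prop :=
  forall An : nat -> set T, (forall n, A (An n)) ->
  exists (Bn : nat -> set T) (k : nat),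
    (forall n, [/\ Bn n `<=` An n, finite_set (Bn n) & Bn n #<= `I_k]) /\
    B (\bigcup_n Bn n).

(* Main.v *)
Require Import Defs.
From mathcomp Require Import all_boot all_order.
From mathcomp Require Import boolp classical_sets functions cardinality topology.

(** The implications from [S_fix 1] to every [S_fix k], and from these to
    [S_bnd], only weaken the bound on the selected sets ([S_fix_le],
    [S_fix_S_bnd]).  The content is that [S_bnd] gives back [S_fix 1].  A
    selection of at most [k] points from each [An n] splits into [k] selections
    of at most one point each: label the points of the [n]-th selected set
    injectively by numbers below [k], and let the [i]-th selection keep only the
    points labelled [i].  The union of the original selection is then the union
    of the [k] unions so obtained.  Since closure commutes with finite unions,
    one of these [k] sets already has [p] in its closure, and the corresponding
    selection witnesses [S_fix 1].  The property of [Omega p] at work is that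
    whenever a finite union belongs to it, one of the pieces does, so this is
    carried out for an arbitrary target family ([S_bnd_S_fix1]). *)

Local Open Scope classical_set_scope.
Local Open Scope card_scope.

(** The hypothesis [~ F set0] is primeness for the empty union; it settles
    [k = 0]. *)
Lemma bigcup_lt_prime (T : Type) (F : set (set T)) (C : nat -> set T)
    (k : nat) :
  ~ F set0 -> (forall Y Z, F (Y `|` Z) -> F Y \/ F Z) ->
  F (\bigcup_(i < k) C i) -> exists i, F (C i).
Proof.
move=> F0 FU; elim: k => [|k IHk]; first by rewrite II0 bigcup_set0.
by rewrite IIS bigcup_setU bigcup_set1 => /FU[/IHk|FCk] //; exists k.
Qed.

Lemma subset1_card_le1 (T : Type) (A : set T) : is_subset1 A -> A #<= `I_1.
Proof.
move=> A1; have [->|/set0P[x Ax]] := eqVneq A set0; first exact: card_ge0.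
have -> : A = [set x] by apply/seteqP; split=> [y Ay|_ ->] //; exact: A1.
by have /card_eqPle[] := @card_set1 T x.
Qed.

Lemma S_fix_le (T : Type) (A B : set (set T)) (j k : nat) :
  (j <= k)%N -> S_fix j A B -> S_fix k A B.
Proof.
move=> jk Sj An /Sj[Bn [BnP BBn]]; exists Bn; split=> // n.
have [BAn Bnj] := BnP n; split=> //.
by apply: card_le_trans Bnj _; rewrite card_le_II.
Qed.

Lemma S_fix_S_bnd (T : Type) (A B : set (set T)) (k : nat) :
  S_fix k A B -> S_bnd A B.
Proof.
move=> Sk An /Sk[Bn [BnP BBn]]; exists Bn, k; split=> // n.
have [BAn Bnk] := BnP n; split=> //.
by apply/finite_set_leP; exists k.
Qed.

(** The bound [k] must be the same for all [n]: it is what makes the number of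
    one-point selections finite, so that finite primeness of [B] applies. *)
Lemma S_bnd_S_fix1 (T : Type) (A B : set (set T)) :
  ~ B set0 -> (forall Y Z, B (Y `|` Z) -> B Y \/ B Z) ->
  S_bnd A B -> S_fix 1 A B.
Proof.
move=> B0 BU Sbnd An /Sbnd[Bn [k [BnP BBn]]].
have lab n : {lab : T -> nat | set_fun (Bn n) `I_k lab /\ set_inj (Bn n) lab}.
  apply: cid; have [_ _ /pcard_leP[f]] := BnP n.
  by exists f; split; [exact: funS | exact: inj].
pose C i := \bigcup_n (Bn n `&` sval (lab n) @^-1` [set i]).
have [i BCi] : exists i, B (C i).
  apply: (@bigcup_lt_prime _ _ C k) => //.
  suff <- : \bigcup_n Bn n = \bigcup_(i < k) C i by [].
  apply/seteqP; split=> [x [n _ Bnx]|x [i _ [n _ [Bnx _]]]]; last by exists n.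
  exists (sval (lab n) x); last by exists n.
  by have [labk _] := svalP (lab n); exact: labk.
exists (fun n => Bn n `&` sval (lab n) @^-1` [set i]); split=> // n; split.
  by have [BAn _ _] := BnP n; apply: subset_trans BAn; exact: subIsetl.
apply: subset1_card_le1 => x y [Bnx labx] [Bny laby].
have [_ labI] := svalP (lab n).
by apply: labI; rewrite ?inE // labx laby.
Qed.

Theorem proposition2p5 (X : topologicalType) (p : X) :
  [<-> S_fix 1 (Omega p) (Omega p);
       forall k : nat, (0 < k)%N -> S_fix k (Omega p) (Omega p);
       S_bnd (Omega p) (Omega p)].
Proof.
split; first by move=> S1 k k0; exact: S_fix_le S1.
split; first by move=> Sk; exact: S_fix_S_bnd (Sk 1 isT).
apply: S_bnd_S_fix1 => [|Y Z]; first by rewrite /Omega /= closure0.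
by rewrite /Omega /= closureU.
Qed.
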